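(* Let $z>0$ and let $(a_n)_{n\ge1}$, $(b_n)_{n\ge0}$ be the three-term recurrence coefficients of the monic orthogonal polynomials with respect to $\langle \mathbf{u}_z,p\rangle=\int_0^\infty p(x)e^{-zx^4}\,dx$. Put $R_n=a_{n+1}+b_n^2+a_n$ and $T_n=a_n(b_n+b_{n-1})$. Then, for all $n\ge0$, $$a_{n+1}\left(T_{n+2}+b_{n+1}R_{n+1}+T_{n+1}\right)\left(T_{n+1}+b_nR_n+T_n\right)=\left[a_{n+1}R_{n+1}+b_nT_{n+1}+a_{n+1}a_n-\frac{n+1}{4z}\right]^2.$$
   Context: The functional $\mathbf{u}_z$ is positive definite; $(P_n)_{n\ge0}$ denotes its sequence of monic orthogonal polynomials. The coefficients $a_n\neq0$ ($n\ge1$) and $b_n$ ($n\ge0$) are defined by $xP_n(x)=P_{n+1}(x)+b_nP_n(x)+a_nP_{n-1}(x)$, $n\ge0$, with $P_{-1}=0$, $P_0=1$. Convention: $a_0=0$ and $b_{-1}=0$, so $T_0=0$. *)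

(* Defs.v *)
From HB Require Import structures.
From mathcomp Require Import all_boot all_order all_algebra.
From mathcomp Require Import all_classical all_reals all_analysis.

Set Implicit Arguments.
Unset Strict Implicit.
Unset Printing Implicit Defensive.

Import Order.TTheory GRing.Theory Num.Theory.

Local Open Scope ring_scope.

(* Rintegral is the [fine] of the extended-real integral; the integrand is
   integrable as soon as z > 0, so no default value is involved then. *)
Definition u_quartic (R : realType) (z : R) (p : {poly R}) : R :=
  \int[lebesgue_measure]_(x in `[0, +oo[) (p.[x] * expR (- (z * x ^+ 4))).

(* [size p = n.+1] means that p has degree n. *)
Definition monic_orthogonal (R : realType) (u : {poly R} -> R)
    (P : nat -> {poly R}) : Prop :=
  [/\ forall n, size (P n) = n.+1 /\ P n \is monic,
      forall m n, m != n -> u (P m * P n) = 0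
    & forall n, u (P n * P n) != 0].

(* The term s_(n-1), with the convention s_(-1) = 0. *)
Definition prev_term (V : zmodType) (s : nat -> V) (n : nat) : V :=
  if n is m.+1 then s m else 0.

(* The recurrence does not constrain a_0, since P_(-1) = 0; the convention
   a_0 = 0 fixes its value. *)
Definition recurrence_coefs (R : realType) (P : nat -> {poly R})
    (a b : nat -> R) : Prop :=
  a 0%N = 0 /\
  forall n, 'X * P n = P n.+1 + b n *: P n + a n *: prev_term P n.

Definition Rcoef (R : realType) (a b : nat -> R) (n : nat) : R :=
  a n.+1 + b n ^+ 2 + a n.

Definition Tcoef (R : realType) (a b : nat -> R) (n : nat) : R :=
  a n * (b n + prev_term b n).

(* Main.v *)
(* Write w = exp (- z x^4) and <p> for the integral of p w over [0, +oo[.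
   Integrating (p w)' gives <p' - 4 z x^3 p> = - p(0) for every polynomial p.
   For p = P_n^2 the derivative term vanishes by orthogonality, so that
   4 z <x^3 P_n^2> = P_n(0)^2; for p = P_n P_(n+1) it equals (n + 1) <P_n^2>, so
   that 4 z <x^3 P_n P_(n+1)> - (n + 1) <P_n^2> = P_n(0) P_(n+1)(0).  The boundary
   values are eliminated by P_n(0)^2 P_(n+1)(0)^2 = (P_n(0) P_(n+1)(0))^2, and the
   recurrence turns the third moments into the stated expressions in a, b. *)
Require Import Defs.
From mathcomp Require Import all_boot all_order all_algebra.
From mathcomp Require Import all_classical all_reals all_analysis.
From mathcomp Require Import measurable_realfun ring.

Import Order.TTheory GRing.Theory Num.Theory.
Import numFieldNormedType.Exports.

Set Implicit Arguments.
Unset Strict Implicit.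

Local Open Scope classical_set_scope.
Local Open Scope ring_scope.

(** * Linear functionals on polynomials and orthogonality to lower degrees *)

Lemma scalarD (R : realType) (L : {poly R} -> R) (hL : scalar L) (p q : {poly R}) :
  L (p + q) = L p + L q.
Proof. by rewrite -[p]scale1r hL scale1r mul1r. Qed.

Lemma scalar0 (R : realType) (L : {poly R} -> R) (hL : scalar L) : L 0 = 0.
Proof. by apply: (addrI (L 0)); rewrite -scalarD// !addr0. Qed.

Lemma scalarZ (R : realType) (L : {poly R} -> R) (hL : scalar L) (c : R)
    (p : {poly R}) : L (c *: p) = c * L p.
Proof. by rewrite -[c *: p]addr0 hL scalar0// addr0. Qed.

Lemma scalarB (R : realType) (L : {poly R} -> R) (hL : scalar L) (p q : {poly R}) :
  L (p - q) = L p - L q.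
Proof. by rewrite scalarD// -scaleN1r scalarZ// mulN1r. Qed.

(** Orthogonality is given only between members of [P]. Since [P k] is monic of degree [k],
    subtracting a multiple of it from a polynomial of size at most [k.+1] lowers the size bound, and
    induction on [k] reaches every [q] of size at most [n]. *)
Lemma monic_orthogonal_small (R : realType) (L : {poly R} -> R) (hL : scalar L)
    (P : nat -> {poly R}) (hP : monic_orthogonal L P) (n : nat) (q : {poly R}) :
  (size q <= n)%N -> L (P n * q) = 0.
Proof.
case: hP => hmon horth _.
suff small k : (k <= n)%N -> forall r : {poly R}, (size r <= k)%N ->
    L (P n * r) = 0 by exact: small.
elim: k => [|k IHk] kn r hr.
  by move: hr; rewrite leqn0 size_poly_eq0 => /eqP ->; rewrite mulr0 scalar0//.
have [sPk mPk] := hmon k.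
have -> : r = (r - r`_k *: P k) + r`_k *: P k by rewrite subrK.
rewrite mulrDr -scalerAr scalarD// scalarZ// horth ?gtn_eqF// mulr0 addr0.
apply: IHk; first exact: ltnW.
apply/leq_sizeP => j; rewrite leq_eqVlt => /predU1P[<-|kj].
  move: mPk; rewrite monicE lead_coefE sPk /= => /eqP Pk1.
  by rewrite coefB coefZ Pk1 mulr1 subrr.
rewrite coefB coefZ [r`_j]nth_default ?(leq_trans hr)//.
by rewrite [(P k)`_j]nth_default ?sPk// mulr0 subr0.
Qed.

(** The derivative of [P n.+1] has leading term [n.+1] times ['X^n]; subtracting [n.+1%:R *: P n]
    leaves a polynomial of size at most [n], which is orthogonal to [P n]. *)
Lemma monic_orthogonal_deriv (R : realType) (L : {poly R} -> R) (hL : scalar L)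
    (P : nat -> {poly R}) (hP : monic_orthogonal L P) (n : nat) :
  L ((P n.+1)^`() * P n) = n.+1%:R * L (P n * P n).
Proof.
have [hmon _ _] := hP.
have [sP mP] := hmon n; have [sP1 mP1] := hmon n.+1.
have -> : (P n.+1)^`() = ((P n.+1)^`() - n.+1%:R *: P n) + n.+1%:R *: P n.
  by rewrite subrK.
rewrite mulrDl -scalerAl scalarD// scalarZ// mulrC monic_orthogonal_small ?add0r//.
apply/leq_sizeP => j; rewrite leq_eqVlt coefB coefZ coef_deriv => /predU1P[<-|nj].
  move: mP mP1; rewrite !monicE !lead_coefE sP sP1 /= => /eqP -> /eqP ->.
  by rewrite mulr1 subrr.
by rewrite !nth_default ?sP ?sP1// mul0rn mulr0 subr0.
Qed.

(** * First and third moments from the three-term recurrence *)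

Lemma recurrence_moment1 (R : realType) (L : {poly R} -> R) (hL : scalar L)
    (P : nat -> {poly R}) (a b : nat -> R) (hP : monic_orthogonal L P)
    (hab : recurrence_coefs P a b) (n : nat) :
  L ('X * (P n * P n)) = b n * L (P n * P n).
Proof.
have [_ horth _] := hP; have [_ hrec] := hab.
rewrite mulrA hrec !mulrDl -!scalerAl !scalarD// !scalarZ// horth ?add0r; last first.
  by rewrite gtn_eqF.
case: n => [|n] /=; first by rewrite mul0r scalar0// mulr0 addr0.
by rewrite (horth n) ?mulr0 ?addr0 // ltn_eqF.
Qed.

Lemma recurrence_moment1S (R : realType) (L : {poly R} -> R) (hL : scalar L)
    (P : nat -> {poly R}) (a b : nat -> R) (hP : monic_orthogonal L P)
    (hab : recurrence_coefs P a b) (n : nat) :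
  L ('X * (P n * P n.+1)) = L (P n.+1 * P n.+1).
Proof.
have [_ horth _] := hP; have [_ hrec] := hab.
rewrite mulrA hrec !mulrDl -!scalerAl !scalarD// !scalarZ// (horth n) ?ltn_eqF// mulr0.
case: n => [|n] /=; first by rewrite mul0r scalar0// mulr0 !addr0.
by rewrite (horth n) ?mulr0 ?addr0 // ltn_eqF.
Qed.

(** Both sides evaluate the first moment of [P n * P n.+1]: the recurrence is applied to ['X * P n]
    for one and to ['X * P n.+1] for the other. *)
Lemma recurrence_normS (R : realType) (L : {poly R} -> R) (hL : scalar L)
    (P : nat -> {poly R}) (a b : nat -> R) (hP : monic_orthogonal L P)
    (hab : recurrence_coefs P a b) (n : nat) :
  L (P n.+1 * P n.+1) = a n.+1 * L (P n * P n).
Proof.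
have [_ horth _] := hP; have [_ hrec] := hab.
rewrite -(recurrence_moment1S hL hP hab) [P n * _]mulrC mulrA hrec.
rewrite !mulrDl -!scalerAl !scalarD// !scalarZ//.
rewrite (horth n.+2 n) ?gtn_eqF// (horth n.+1 n) ?gtn_eqF// mulr0.
by rewrite !add0r.
Qed.

Lemma recurrence_moment1_far (R : realType) (L : {poly R} -> R) (hL : scalar L)
    (P : nat -> {poly R}) (a b : nat -> R) (hP : monic_orthogonal L P)
    (hab : recurrence_coefs P a b) (m n : nat) :
  (m.+1 < n)%N -> L ('X * (P m * P n)) = 0.
Proof.
move=> mn; have [hmon _ _] := hP.
rewrite mulrA mulrC monic_orthogonal_small//.
rewrite (leq_trans (size_polyMleq _ _))// size_polyX (proj1 (hmon m)).
exact: mn.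
Qed.

(** Two of the three factors ['X] are absorbed by the recurrence, one into each [P n]; the expansion
    then involves only first moments, all multiples of the squared norm of [P n] or of its
    predecessor. *)
Lemma recurrence_moment3 (R : realType) (L : {poly R} -> R) (hL : scalar L)
    (P : nat -> {poly R}) (a b : nat -> R) (hP : monic_orthogonal L P)
    (hab : recurrence_coefs P a b) (n : nat) :
  L ('X ^+ 3 * (P n * P n)) =
  (Tcoef a b n.+1 + b n * Rcoef a b n + Tcoef a b n) * L (P n * P n).
Proof.
have [a0 hrec] := hab.
have -> : 'X ^+ 3 * (P n * P n) = 'X * (('X * P n) * ('X * P n)) by ring.
rewrite hrec /Tcoef /Rcoef /=.
have -> : 'X * ((P n.+1 + b n *: P n + a n *: prev_term P n) *
                (P n.+1 + b n *: P n + a n *: prev_term P n)) =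
  'X * (P n.+1 * P n.+1) + b n ^+ 2 *: ('X * (P n * P n))
  + (2 * b n) *: ('X * (P n * P n.+1))
  + a n ^+ 2 *: ('X * (prev_term P n * prev_term P n))
  + (2 * a n) *: ('X * (prev_term P n * P n.+1))
  + (2 * a n * b n) *: ('X * (prev_term P n * P n)).
  by rewrite -!mul_polyC !rmorphM/= ?rmorph_nat; ring.
rewrite !(scalarD hL) !(scalarZ hL) !(recurrence_moment1 hL hP hab).
rewrite !(recurrence_moment1S hL hP hab).
(* For [n = 0] every term containing [prev_term P n] carries a factor [a 0], which is zero by
   convention. *)
case: n => [|n] /=.
  rewrite a0 (recurrence_normS hL hP hab).
  by set h := L _; ring.
rewrite !(recurrence_moment1 hL hP hab).
rewrite !(recurrence_moment1S hL hP hab).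
rewrite (recurrence_moment1_far hL hP hab)//.
rewrite !(recurrence_normS hL hP hab).
by set h := L _; ring.
Qed.

Lemma recurrence_moment3S (R : realType) (L : {poly R} -> R) (hL : scalar L)
    (P : nat -> {poly R}) (a b : nat -> R) (hP : monic_orthogonal L P)
    (hab : recurrence_coefs P a b) (n : nat) :
  L ('X ^+ 3 * (P n * P n.+1)) =
  (a n.+1 * Rcoef a b n.+1 + b n * Tcoef a b n.+1 + a n.+1 * a n)
    * L (P n * P n).
Proof.
have [a0 hrec] := hab.
have -> : 'X ^+ 3 * (P n * P n.+1) = 'X * (('X * P n) * ('X * P n.+1)) by ring.
rewrite !hrec /Tcoef /Rcoef /=.
have -> : 'X * ((P n.+1 + b n *: P n + a n *: prev_term P n) *
                (P n.+2 + b n.+1 *: P n.+1 + a n.+1 *: P n)) =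
  'X * (P n.+1 * P n.+2) + b n.+1 *: ('X * (P n.+1 * P n.+1))
  + (a n.+1 + b n * b n.+1) *: ('X * (P n * P n.+1))
  + b n *: ('X * (P n * P n.+2)) + (b n * a n.+1) *: ('X * (P n * P n))
  + a n *: ('X * (prev_term P n * P n.+2))
  + (a n * b n.+1) *: ('X * (prev_term P n * P n.+1))
  + (a n * a n.+1) *: ('X * (prev_term P n * P n)).
  by rewrite -!mul_polyC !rmorphD/= !rmorphM/=; ring.
rewrite !(scalarD hL) !(scalarZ hL) !(recurrence_moment1 hL hP hab).
rewrite !(recurrence_moment1S hL hP hab).
(* The indices differ by two, so this moment vanishes for every [n]; those containing
   [prev_term P n] wait for the case split. *)
rewrite (@recurrence_moment1_far _ _ hL _ _ _ hP hab n n.+2)//.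
case: n => [|n] /=.
  rewrite a0 !(recurrence_normS hL hP hab).
  by set h := L _; ring.
rewrite !(recurrence_moment1S hL hP hab).
rewrite !(recurrence_moment1_far hL hP hab)//.
rewrite !(recurrence_normS hL hP hab).
by set h := L _; ring.
Qed.

(** * The identity for an abstract functional *)

(** The analysis enters only through linearity and [pearson], the integrated form of the derivative
    of a polynomial times the weight; the rest is algebra. *)
Lemma laguerre_freud_quartic (R : realType) (L : {poly R} -> R)
    (hL : scalar L) (z : R) (hz : z != 0)
    (pearson : forall p, L (p^`() - (4 * z) *: ('X ^+ 3 * p)) = - p.[0])
    (P : nat -> {poly R}) (a b : nat -> R) (hP : monic_orthogonal L P)
    (hab : recurrence_coefs P a b) (n : nat) :
  a n.+1
    * (Tcoef a b n.+2 + b n.+1 * Rcoef a b n.+1 + Tcoef a b n.+1)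
    * (Tcoef a b n.+1 + b n * Rcoef a b n + Tcoef a b n)
  = (a n.+1 * Rcoef a b n.+1 + b n * Tcoef a b n.+1 + a n.+1 * a n
      - n.+1%:R / (4 * z)) ^+ 2.
Proof.
have [hmon horth hnz] := hP.
have small k m : (k <= m)%N -> L ((P k)^`() * P m) = 0.
  move=> km; rewrite mulrC monic_orthogonal_small//.
  rewrite (leq_trans (size_poly _ _))//.
  by rewrite (proj1 (hmon k)).
have diag k : (4 * z)
    * ((Tcoef a b k.+1 + b k * Rcoef a b k + Tcoef a b k) * L (P k * P k))
    = (P k).[0] ^+ 2.
  rewrite -(recurrence_moment3 hL hP hab).
  have := pearson (P k * P k).
  rewrite scalarB// scalarZ// derivM scalarD// [P k * _^`()]mulrC !small// hornerM.
  by rewrite addr0 sub0r expr2 => /oppr_inj.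
have offdiag : (4 * z) * ((a n.+1 * Rcoef a b n.+1 + b n * Tcoef a b n.+1
    + a n.+1 * a n) * L (P n * P n)) - n.+1%:R * L (P n * P n)
    = (P n).[0] * (P n.+1).[0].
  rewrite -(recurrence_moment3S hL hP hab).
  have := pearson (P n * P n.+1).
  rewrite scalarB// scalarZ// derivM scalarD// small// [P n * _^`()]mulrC.
  rewrite monic_orthogonal_deriv// hornerM add0r => /(congr1 -%R).
  by rewrite opprB opprK.
have := diag n; have := diag n.+1; rewrite (recurrence_normS hL hP hab).
move: offdiag (hnz n).
set c := _ + a n.+1 * a n; set d := Tcoef a b n.+2 + _ + _.
set e := Tcoef a b n.+1 + _ + _; set h := L _; set x := (P n).[0].
set y := (P n.+1).[0] => E h0 E1 E0.
have z4 : 4 * z != 0 by rewrite mulf_neq0// pnatr_eq0.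
(* After multiplication by the nonzero [(4 * z * h) ^+ 2], the right side is the square of the
   off-diagonal relation [E]. On the left, [a n.+1 * h] is the next squared norm, so the product of
   [E1] and [E0] appears. *)
apply: (mulfI (expf_neq0 2 (mulf_neq0 z4 h0))).
have -> : (4 * z * h) ^+ 2 * (c - n.+1%:R / (4 * z)) ^+ 2
   = (4 * z * (c * h) - n.+1%:R * h) ^+ 2 by field.
rewrite E [RHS]exprMn -E0 -E1; ring.
Qed.

(** * Growth of polynomials against the quartic exponential *)

Lemma poly_le_expR_quartic (R : realType) (p : {poly R}) (z : R) : 0 < z ->
  exists C, forall x, `|p.[x]| <= C * expR (z * x ^+ 4).
Proof.
(* Half of the rate absorbs the factor x, the other half is left for p; hence z
   has to vary in the induction. *)
elim/poly_ind: p z => [|p c IHp] z z0.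
  by exists 0 => x; rewrite horner0 normr0 mul0r.
have z20 : 0 < z / 2 by rewrite divr_gt0.
have [C hC] := IHp _ z20.
(* The factor [1 + 2 / z] comes from [|x| <= 1 + x ^+ 4] and from [1 + t <= expR t] at
   [t = z / 2 * x ^+ 4]; the constant term [c] only needs the exponential to be at least 1. *)
exists (C * (1 + 2 / z) + `|c|) => x.
have x4 : 0 <= x ^+ 4 by rewrite exprn_even_ge0.
have x4n : x ^+ 4 = `|x| ^+ 4.
  by rewrite -normrX ger0_norm.
have expz : expR (z * x ^+ 4) = expR (z / 2 * x ^+ 4) * expR (z / 2 * x ^+ 4).
  by rewrite -expRD; congr expR; field.
rewrite hornerMXaddC (le_trans (ler_normD _ _))// normrM.
have e1 : 1 <= expR (z / 2 * x ^+ 4).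
  by rewrite -[leLHS]expR0 ler_expR mulr_ge0// ltW.
have xe : `|x| <= (1 + 2 / z) * expR (z / 2 * x ^+ 4).
  have le1 : `|x| <= 1 + x ^+ 4.
    rewrite x4n; have := normr_ge0 x; move: `|x| => y y0.
    have [y1|y1] := leP y 1; first by rewrite (le_trans y1)// lerDl exprn_ge0.
    by rewrite (@le_trans _ _ (y ^+ 4))// ?lerDr// ler_eXnr// ltW.
  rewrite (le_trans le1)// mulrDl lerD ?mul1r//.
  rewrite -ler_pdivrMl ?divr_gt0// invf_div.
  by rewrite (le_trans _ (expR_ge1Dx _))// lerDr.
rewrite mulrDl lerD//.
  by rewrite expz mulrACA ler_pM.
rewrite ler_peMr// expz.
by rewrite (le_trans e1)// ler_peMl// expR_ge0.
Qed.

(** The growth bound is applied to [p * (1 + 'X ^+ 2)], which gives a majorant that is integrable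
    and has the explicit primitive [C * atan x]. *)
Lemma poly_quartic_le (R : realType) (p : {poly R}) (z : R) : 0 < z ->
  exists C, forall x, `|p.[x] * expR (- (z * x ^+ 4))| <= C * (1 + x ^+ 2)^-1.
Proof.
move=> z0; have [C hC] := poly_le_expR_quartic (p * (1 + 'X ^+ 2)) z0.
exists C => x; have := hC x.
have x2 : 0 < 1 + x ^+ 2 by rewrite ltr_pwDl// sqr_ge0.
rewrite hornerM hornerD hornerC hornerXn !normrM (gtr0_norm x2) => h.
rewrite (ger0_norm (expR_ge0 _)) ler_pdivlMr// expRN mulrAC ler_pdivrMr//.
exact: expR_gt0.
Qed.

(** * Derivative, decay and integral of a polynomial times the weight *)

Definition quartic_fun (R : realType) (z : R) (p : {poly R}) (x : R) : R :=
  p.[x] * expR (- (z * x ^+ 4)).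

Lemma is_derive_quartic_fun (R : realType) (z : R) (p : {poly R}) (x : R) :
  is_derive x 1 (quartic_fun z p)
    (quartic_fun z (p^`() - (4 * z) *: ('X ^+ 3 * p)) x).
Proof.
(* In this form the derivative is found by instance resolution. *)
have -> : quartic_fun z p = horner p * (expR \o horner (- z *: 'X^4)).
  by apply/funext => y; rewrite /quartic_fun !fctE/= hornerZ hornerXn mulNr.
apply: is_derive_eq.
rewrite /quartic_fun /= derivZ derivXn /= !hornerE /= /GRing.scale /=.
by rewrite !mulNr; ring.
Qed.

Lemma continuous_quartic_fun (R : realType) (z : R) (p : {poly R}) :
  continuous (quartic_fun z p).
Proof.
move=> x; apply: differentiable_continuous; apply/derivable1_diffP.
by have [] := is_derive_quartic_fun z p x.
Qed.

Lemma cvg_quartic_fun (R : realType) (z : R) (z0 : 0 < z) (p : {poly R}) :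
  quartic_fun z p x @[x --> +oo] --> (0 : R).
Proof.
have [C hC] := poly_quartic_le p z0.
apply/cvgrPdist_le => e e0; near=> x.
rewrite sub0r normrN (le_trans (hC x))// ler_pdivrMr ?ltr_pwDl ?sqr_ge0//.
(* These two thresholds give [C <= e * x] and [x <= x ^+ 2], hence [C <= e * (1 + x ^+ 2)]. *)
have x1 : 1 <= x by near: x; apply: nbhs_pinfty_ge; exact: num_real.
have Cx : C / e <= x by near: x; apply: nbhs_pinfty_ge; exact: num_real.
move: Cx; rewrite ler_pdivrMr// => /le_trans; apply.
rewrite mulrC ler_pM2l// (@le_trans _ _ (x ^+ 2))// ?lerDr// expr2.
by rewrite ler_peMl// (le_trans ler01).
Unshelve. end_near. Qed.

Lemma integrable_oneDsqrV (R : realType) :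
  lebesgue_measure.-integrable `[0, +oo[ (EFin \o (fun x : R => (oneDsqr x)^-1)).
Proof.
apply/integrableP; split.
  apply/measurable_EFinP; apply: measurable_funTS; apply: continuous_measurable_fun.
  exact: continuous_oneDsqrV.
under eq_integral do
  rewrite /= ger0_norm ?invr_ge0 ?(le_trans ler01 (oneDsqr_ge1 _))//.
by rewrite integral0y_oneDsqr ltry.
Qed.

Lemma integrableZ_oneDsqrV (R : realType) (C : R) :
  lebesgue_measure.-integrable `[0, +oo[
    (EFin \o (fun x : R => C * (oneDsqr x)^-1)).
Proof.
move: (integrable_oneDsqrV R) => /(integrableZl _ C); exact.
Qed.

Lemma integrable_quartic_fun (R : realType) (z : R) (z0 : 0 < z) (p : {poly R}) :
  lebesgue_measure.-integrable `[0, +oo[ (EFin \o quartic_fun z p).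
Proof.
have [C hC] := poly_quartic_le p z0.
have iC := integrableZ_oneDsqrV C.
apply: le_integrable iC => //.
- apply/measurable_EFinP; apply: measurable_funTS; apply: continuous_measurable_fun.
  exact: continuous_quartic_fun.
- by move=> x _ /=; rewrite lee_fin (le_trans (hC x))// ler_norm.
Qed.

Lemma Rintegral_deriv_quartic_fun (R : realType) (z : R) (z0 : 0 < z) (p : {poly R}) :
  \int[lebesgue_measure]_(x in `[0, +oo[)
    quartic_fun z (p^`() - (4 * z) *: ('X ^+ 3 * p)) x = - p.[0].
Proof.
set q := (X in quartic_fun z X).
have [C hC] := poly_quartic_le q z0.
(* The library's fundamental theorem on a half-line needs a nonnegative
   integrand; adding C / (1 + x ^ 2) and its primitive C * atan x provides one. *)
pose F (x : R) := quartic_fun z p x + C * atan x.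
pose f x := quartic_fun z q x + C * (oneDsqr x)^-1.
have dF (x : R) : is_derive x 1 F (f x).
  exact: is_deriveD (is_derive_quartic_fun z p x) (is_deriveZ C (is_derive1_atan x)).
have cF x : {for x, continuous F}.
  by apply/differentiable_continuous/derivable1_diffP; have [] := dF x.
have cf : continuous f.
  move=> x; apply: cvgD; first exact: continuous_quartic_fun.
  by apply: cvgM; [exact: cvg_cst|exact: continuous_oneDsqrV].
have Fl : F x @[x --> +oo] --> 0 + C * (pi / 2).
  by apply: cvgD; [exact: cvg_quartic_fun|apply: cvgM; [exact: cvg_cst|exact: cvgy_atan]].
have f0 x : 0 <= x -> 0 <= f x.
  move=> _; have := hC x; rewrite ler_norml => /andP[+ _].
  by rewrite lerNl -subr_ge0 opprK addrC.
have If := Rintegral_ge0_continuous_FTC2y f0 _ Fl.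
have {If} If : \int[lebesgue_measure]_(x in `[0, +oo[) f x = 0 + C * (pi / 2) - F 0.
  apply: If.
  - exact: continuous_subspaceT.
  - by move=> x _; have [] := dF x.
  - exact: cvg_at_right_filter (cF 0).
  - by move=> x _; rewrite derive1E derive_val.
have Ia : \int[lebesgue_measure]_(x in `[0, +oo[) (oneDsqr x)^-1 = pi / 2 :> R.
  by rewrite /Rintegral integral0y_oneDsqr.
have iC := integrableZ_oneDsqrV C.
have iq := integrable_quartic_fun z0 q.
(* The added term integrates to [C * (pi / 2)], which cancels against the limit of [F]; what remains
   is [- F 0], and [atan 0 = 0]. *)
move: If; rewrite /f RintegralD//.
rewrite RintegralZl//; last exact: integrable_oneDsqrV.
rewrite Ia add0r addrC => /addrI ->.
by rewrite /F /quartic_fun atan0 mulr0 addr0 expr0n/= mulr0 oppr0 expR0 mulr1.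
Qed.

(** * Application to the functional of the quartic weight *)

Lemma scalar_u_quartic (R : realType) (z : R) : 0 < z -> scalar (u_quartic z).
Proof.
move=> z0 c p q; rewrite /u_quartic.
have ip := integrable_quartic_fun z0 p; have iq := integrable_quartic_fun z0 q.
have icp : lebesgue_measure.-integrable `[0, +oo[
    (EFin \o (fun x : R => c * quartic_fun z p x)).
  by move: ip => /(integrableZl _ c); exact.
rewrite -[X in c * X]/(
  \int[lebesgue_measure]_(x in `[0, +oo[) quartic_fun z p x).
rewrite -RintegralZl// -RintegralD//; apply: eq_Rintegral => x _.
by rewrite hornerD hornerZ mulrDl -mulrA.
Qed.

Theorem theorem4p3 (R : realType) (z : R) (hz : 0 < z)
    (P : nat -> {poly R}) (a b : nat -> R)
    (hP : monic_orthogonal (u_quartic z) P)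
    (hab : recurrence_coefs P a b) (n : nat) :
  a n.+1
    * (Tcoef a b n.+2 + b n.+1 * Rcoef a b n.+1 + Tcoef a b n.+1)
    * (Tcoef a b n.+1 + b n * Rcoef a b n + Tcoef a b n)
  = (a n.+1 * Rcoef a b n.+1 + b n * Tcoef a b n.+1 + a n.+1 * a n
      - n.+1%:R / (4 * z)) ^+ 2.
Proof.
apply: (laguerre_freud_quartic (scalar_u_quartic hz) _ _ hP hab).
  by rewrite gt_eqF.
exact: Rintegral_deriv_quartic_fun.
Qed.
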